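(* Let $n>30$ be an integer of the form $n=lN_k$ with integers $k\ge 1$, $l\ge 1$ and $lN_k<N_{k+1}$ (that is, $n$ is a primorial number or a multiple of a primorial number smaller than the next primorial number). Then $$\frac{\psi(n)}{n}-e^{\gamma}\log\log n<0.$$
   Context: The Dedekind psi function is defined for positive integers $n$ by $\psi(n)=n\prod_{p\mid n}\left(1+\frac1p\right)$, where the product is over the primes $p$ dividing $n$. $\gamma\approx 0.577$ is Euler's constant and $\log$ is the natural logarithm. $p_i$ denotes the $i$-th prime ($p_1=2$), and $N_k=\prod_{i=1}^k p_i$ is the $k$-th primorial number. The numbers $lN_k$ with $k,l\ge 1$ and $lN_k<N_{k+1}$ form Sloane's sequence A060735. *)

(* Defs.v *)
From mathcomp Require Import all_boot all_order all_algebra.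
From mathcomp Require Import all_classical all_reals all_analysis.

Set Implicit Arguments.
Unset Strict Implicit.
Unset Printing Implicit Defensive.

Import Order.TTheory GRing.Theory Num.Theory.
Import numFieldNormedType.Exports.

Local Open Scope ring_scope.

Definition dedekind_psi (R : realType) (n : nat) : R :=
  n%:R * \prod_(p <- primes n) (1 + p%:R^-1).

(* [series harmonic n] is the [n]-th harmonic number 1 + 1/2 + ... + 1/n. *)
Definition euler_gamma (R : realType) : R :=
  limn (fun n : nat => series harmonic n - ln (n%:R : R)).

Fact ex_prime_above (m : nat) : exists p : nat, (m < p)%N && prime p.
Proof. by case: (prime_above m) => p lt_mp pr_p; exists p; apply/andP. Qed.

(* The least prime greater than [m]. *)
Definition next_prime (m : nat) : nat := ex_minn (ex_prime_above m).

(* Primes are indexed from 1: [nth_prime 1 = 2], [nth_prime 2 = 3], and so on.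
   The value [nth_prime 0 = 1] is only a seed for the recursion. *)
Fixpoint nth_prime (i : nat) : nat :=
  if i is j.+1 then next_prime (nth_prime j) else 1%N.

Definition primorial (k : nat) : nat := (\prod_(1 <= i < k.+1) nth_prime i)%N.

(* Main.v *)
From Stdlib Require Import NArith.
Require Import Defs.
From mathcomp Require Import all_boot all_order all_algebra.
From mathcomp Require Import all_classical all_reals all_analysis.
From mathcomp Require Import ring lra zify.

Import Order.TTheory GRing.Theory Num.Theory.
Import numFieldNormedType.Exports.

Local Open Scope ring_scope.

(** Since [l] is smaller than the prime following [p_k], the prime divisors of
    [n = l * primorial k] are exactly the primes up to [x = p_k].  Hence
    [dedekind_psi n / n] is the product [P x] of the [1 + 1 / p] over [p <= x]
    ([dedekind_psi_primorial]), while [ln n >= ln (primorial k)], which is Chebyshev's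
    [theta x] ([theta_nth_prime]).  So the claim follows from
    [P x < exp gamma * ln (theta x)].

    There is room in this inequality: by Mertens' theorem [P x] is asymptotic to
    [(6 / pi ^ 2) * exp gamma * ln x], and [6 / pi ^ 2] is about [0.61].  Crude explicit
    estimates are therefore enough, with [exp gamma] replaced by [1.72]
    ([expR_euler_gamma_ge]).

    For [x >= 1024] the three ingredients are the following.  First, Legendre's formula for
    [n!], Stirling's upper bound and [theta n <= n ln 4] bound the sum of [ln p / p] over
    [p <= n] by [ln n] plus a constant ([mertens_sum_le]).  Second, partial summation turns
    this into a bound of [P x] by a constant times [ln x], where the constant involves only
    the values at 1024 of the product and of the sum ([ln_psi_prod_le]); they are computed
    ([psi_prod_1024], [mertens_sum_1024]).  Third, the prime factorisation of the central
    binomial coefficient gives [theta x >= 0.46 x] ([theta_ge]), so [ln (theta x)] is at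
    least [ln x - 0.8].

    For [7 <= x < 1024] the monotonicity of both sides reduces the claim to five numerical
    verifications ([psi_prod_lt]).  The remaining case is [x = 5], where [n > 30] is a
    multiple of 30 and so [n >= 60]; for smaller [x] there is no such [n]. *)

(** * Bounds for the exponential and the logarithm *)

Definition exp_taylor3 (R : realType) (x : R) : R := 1 + x + x ^+ 2 / 2 + x ^+ 3 / 6.

(** With [g t = exp (- t) * exp_taylor3 t], all terms of the derivative but one
    cancel: [g' t = - exp (- t) * t ^ 3 / 6].  So [g] increases up to [0], decreases
    after it, and its maximum is [g 0 = 1]; the bound therefore holds on both sides of
    [0]. *)
Lemma exp_taylor3_le (R : realType) (x : R) : exp_taylor3 R x <= expR x.
Proof.
pose g (t : R) : R := expR (- t) * exp_taylor3 R t.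
have dg : forall t : R, is_derive t (1 : R) g (- expR (- t) * t ^+ 3 / 6).
  move=> t; rewrite /g /exp_taylor3; apply: is_derive_eq.
  by rewrite /GRing.scale /=; field.
have cg : continuous g.
  by move=> t; apply/differentiable_continuous/derivable1_diffP; apply: ex_derive.
have dgE t : derive1 g t = - expR (- t) * t ^+ 3 / 6 by rewrite derive1E derive_val.
have dv t : derivable g t 1 by [].
have g0 : g 0 = 1 by rewrite /g /exp_taylor3 oppr0 expR0; field.
suff gx : g x <= 1.
  by rewrite -(mul1r (expR x)) -ler_pdivrMr ?expR_gt0// -expRN mulrC.
rewrite -g0; have [x0|x0] := leP 0 x.
- apply: (@ler0_derive1_nincr _ g 0 x) => // [t|].
    rewrite in_itv/= => /andP[t0 _]; rewrite dgE.
    have := expR_gt0 (- t); have := exprn_gt0 3 t0; nra.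
  exact: continuous_subspaceT.
- apply: (@ger0_derive1_ndecr _ g x 0) => // [t||].
  + rewrite in_itv/= => /andP[_ t0]; rewrite dgE.
    have := expR_gt0 (- t); have : t ^+ 3 < 0 by rewrite exprS pmulr_llt0 // exprn_even_gt0 //= lt_eqF.
    nra.
  + exact: continuous_subspaceT.
  + exact: ltW.
Qed.

(** A certificate for upper bounds of [exp]: the Taylor bound is applied at the small
    negative point [- q / N] and raised to the power [N], which leaves an inequality
    between rational numbers. *)
Lemma expR_le_taylor3 (R : realType) (q y : R) (N : nat) :
  (0 < N)%N -> 0 < exp_taylor3 R (- (q / N%:R)) ->
  1 <= y * exp_taylor3 R (- (q / N%:R)) ^+ N -> expR q <= y.
Proof.
move=> N0 t0 h.
have N0' : N%:R != 0 :> R by rewrite pnatr_eq0 -lt0n.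
have e : expR (- q) = expR (- (q / N%:R)) ^+ N.
  by rewrite -expRM_natl mulrN mulrC divfK.
have := expRxMexpNx_1 q; rewrite e => e1.
have y0 : 0 <= y.
  rewrite leNgt; apply/negP => y0.
  by have := le_lt_trans h (_ : y * _ < 0); rewrite ltr10 nmulr_rlt0 ?exprn_gt0// => /(_ isT).
have h2 := lerXn2r N (ltW t0) (expR_ge0 _) (exp_taylor3_le R (- (q / N%:R))).
rewrite -(ler_pM2r (exprn_gt0 N (expR_gt0 (- (q / N%:R))))) e1.
apply: le_trans h _; exact: ler_wpM2l.
Qed.

Lemma ge_ln_taylor3 (R : realType) (q y : R) (N : nat) :
  (0 < N)%N -> 0 < exp_taylor3 R (- (q / N%:R)) ->
  1 <= y * exp_taylor3 R (- (q / N%:R)) ^+ N -> 0 < y -> q <= ln y.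
Proof.
move=> N0 t0 h y0.
by rewrite -(expRK q) ler_ln ?posrE ?expR_gt0// (expR_le_taylor3 _ _ _ N).
Qed.

Lemma ln2_ge (R : realType) : 69 / 100 <= ln (2 : R).
Proof. by apply: (@ge_ln_taylor3 _ _ _ 8) => //; rewrite /exp_taylor3; lra. Qed.

Lemma ln2_le (R : realType) : ln (2 : R) <= 7 / 10.
Proof.
rewrite -(expRK (7/10 : R)) ler_ln ?posrE ?expR_gt0//.
apply: le_trans (exp_taylor3_le _ _); rewrite /exp_taylor3; lra.
Qed.

Lemma ln60_ge (R : realType) : 408 / 100 <= ln (60 : R).
Proof. by apply: (@ge_ln_taylor3 _ _ _ 16) => //; rewrite /exp_taylor3; lra. Qed.

Lemma ln_ge_1sub_inv (R : realType) (x : R) : 0 < x -> 1 - x^-1 <= ln x.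
Proof.
move=> x0; have := @le_ln1Dx R (x^-1 - 1).
have -> : 1 + (x^-1 - 1) = x^-1 by ring.
rewrite lnV ?posrE// => h; have : 0 < x^-1 by rewrite invr_gt0.
by move=> xV0; have := h ltac:(lra); lra.
Qed.

Lemma ln_succ_sub_le (R : realType) (n : nat) : (0 < n)%N ->
  n.+1%:R^-1 <= ln n.+1%:R - ln (n%:R : R) <= n%:R^-1.
Proof.
move=> n0; have n0' : 0 < n%:R :> R by rewrite ltr0n.
have S0 : 0 < n.+1%:R :> R by rewrite ltr0n.
have e : (n.+1%:R : R) = n%:R + 1 by rewrite natr1.
rewrite -ln_div ?posrE//; apply/andP; split.
  apply: le_trans (ln_ge_1sub_inv _ _ (divr_gt0 S0 n0')).
  rewrite invf_div e -subr_ge0 (_ : _ - _ = 0) //; field; rewrite -e; lra.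
rewrite (_ : n.+1%:R / n%:R = 1 + n%:R^-1 :> R); last by rewrite e; field; lra.
apply: le_ln1Dx; have : 0 < n%:R^-1 :> R by rewrite invr_gt0.
lra.
Qed.

Lemma ln_le_tangent (R : realType) (a x : R) : 0 < a -> 0 < x ->
  ln x <= ln a + x / a - 1.
Proof.
move=> a0 x0; have := @le_ln1Dx R (x / a - 1).
have -> : 1 + (x / a - 1) = x / a by ring.
rewrite ln_div ?posrE // => h; have xa : 0 < x / a by exact: divr_gt0.
by have := h ltac:(lra); lra.
Qed.

(** The function [(1 + ln x) / x] decreases on [x >= 1]. *)
Lemma ln_div_le (R : realType) (m n : nat) : (0 < m)%N -> (m <= n)%N ->
  (1 + ln n%:R) / n%:R <= (1 + ln m%:R) / m%:R :> R.
Proof.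
move=> m0 mn; have m0' : 0 < m%:R :> R by rewrite ltr0n.
have mn' : m%:R <= n%:R :> R by rewrite ler_nat.
have n0' : 0 < n%:R :> R by apply: lt_le_trans mn'.
have lm : 0 <= ln m%:R :> R by rewrite ln_ge0 // ler1n.
rewrite ler_pdivrMr //; have := @ln_le_tangent R _ _ m0' n0'.
have -> : (1 + ln m%:R) / m%:R * n%:R = n%:R / m%:R + ln m%:R * (n%:R / m%:R) :> R by ring.
have : 1 <= n%:R / m%:R :> R by rewrite ler_pdivlMr // mul1r.
nra.
Qed.

(** * Euler's constant *)

(** The sequence [H_n - ln n] decreases from [n = 1] on, [H_n - ln (n + 1)] increases and
    stays below it, so the limit exists and is at least every term of the latter. *)
Lemma euler_gamma_ge (R : realType) (n : nat) :
  series harmonic n - ln (n.+1%:R : R) <= euler_gamma R.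
Proof.
pose u (i : nat) : R := series harmonic i - ln (i%:R : R).
pose v (i : nat) : R := series harmonic i - ln (i.+1%:R : R).
have hS i : series (@harmonic R) i.+1 = series harmonic i + i.+1%:R^-1.
  by rewrite /series /= big_nat_recr.
have v_incr : nondecreasing_seq v.
  apply/nondecreasing_seqP => i; rewrite /v hS.
  have /andP[_ h] := @ln_succ_sub_le R i.+1 isT.
  by rewrite -addrA lerD2l lerBrDl.
have vu i : v i <= u i.
  rewrite /u /v lerD2l lerN2; case: i => [|i]; first by rewrite ln0 // ln1.
  by rewrite ler_ln ?posrE ?ltr0n // ler_nat.
have u_decr : nonincreasing_seq (fun i => u i.+1).
  apply/nonincreasing_seqP => i; rewrite /u (hS i.+1).
  have /andP[h _] := @ln_succ_sub_le R i.+1 isT.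
  by rewrite -addrA lerD2l lerBlDr [leRHS]addrC.
(* The sequence starts with 0, then 1, and decreases only from there: shift by one. *)
have u_cvg : cvgn (fun i => u i.+1).
  apply: nonincreasing_is_cvgn => //; exists (v 0%N) => _ [i _ <-].
  by apply: le_trans (vu i.+1); apply: v_incr.
have -> : euler_gamma R = limn (fun i => u i.+1).
  rewrite /euler_gamma -/u; apply/cvg_lim => //.
  by rewrite -cvg_shiftS.
apply: limr_ge => //; near=> i.
apply: le_trans (vu i.+1); apply: v_incr; near: i.
exists n => // i /= ni; exact: leqW.
Unshelve. all: by end_near. Qed.

(** The term [n = 15] of [euler_gamma_ge] gives [exp (H_15) / 16], about 1.725. *)
Lemma expR_euler_gamma_ge (R : realType) : 172 / 100 <= expR (euler_gamma R).
Proof.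
apply: le_trans (_ : expR (series harmonic 15 - ln 16) <= _); last first.
  by rewrite ler_expR; exact: euler_gamma_ge.
rewrite expRB lnK ?posrE// ler_pdivlMr//.
have h : 3318 / 1000 <= series harmonic 15 :> R.
  have -> : series harmonic 15 = \sum_(0 <= k < 15) k.+1%:R^-1 :> R by [].
  by rewrite !big_nat_recr//= big_geq//; lra.
apply: le_trans (_ : expR (16%:R * (3318 / 16000)) <= _); last first.
  by rewrite ler_expR; apply: le_trans h; lra.
have t0 : 0 <= exp_taylor3 R (3318 / 16000) by rewrite /exp_taylor3; lra.
rewrite expRM_natl; apply: le_trans (lerXn2r 16 t0 (expR_ge0 _) (exp_taylor3_le _ _)).
rewrite /exp_taylor3; lra.
Qed.

(** * Primes up to a bound *)

Definition primes_le (x : nat) : seq nat := [seq p <- iota 1 x | prime p].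
Arguments primes_le : simpl never.

Lemma mem_primes_le (x p : nat) : (p \in primes_le x) = prime p && (p <= x)%N.
Proof.
rewrite mem_filter mem_iota; case: (boolP (prime p)) => //= /prime_gt0 ->.
by rewrite add1n ltnS.
Qed.

Lemma primes_le_uniq (x : nat) : uniq (primes_le x).
Proof. by rewrite filter_uniq // iota_uniq. Qed.

Lemma primes_leS (x : nat) :
  primes_le x.+1 = primes_le x ++ (if prime x.+1 then [:: x.+1] else [::]).
Proof. by rewrite /primes_le -[X in iota _ X]addn1 iotaD filter_cat /= add1n. Qed.

Lemma primes_le_prime (x p : nat) : p \in primes_le x -> prime p.
Proof. by rewrite mem_primes_le => /andP[]. Qed.

Lemma prime_natr_gt1 (R : realType) (p : nat) : prime p -> 1 < p%:R :> R.
Proof. by move=> /prime_gt1 h; rewrite ltr1n. Qed.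

Lemma ln_prime_gt0 (R : realType) (p : nat) : prime p -> 0 < ln (p%:R : R).
Proof. by move=> /(prime_natr_gt1 R)/ln_gt0. Qed.

(** Unique factorisation in logarithmic form.  Summing over all primes up to a common bound
    [x], and not only over the divisors of [m], lets several integers be compared prime by
    prime. *)
Lemma ln_logn (R : realType) (x m : nat) : (0 < m)%N ->
  (forall q, prime q -> (q %| m)%N -> (q <= x)%N) ->
  ln (m%:R : R) = \sum_(p <- primes_le x) (logn p m)%:R * ln p%:R.
Proof.
move=> m0 mx.
have pm : perm_eq (primes m) [seq p <- primes_le x | p %| m]%N.
  apply: uniq_perm; [exact: primes_uniq|by rewrite filter_uniq // primes_le_uniq|].
  move=> p; rewrite mem_filter mem_primes_le mem_primes m0 /= andbC.
  by case: (boolP (prime p)) => pp; rewrite ?andbF //; case: (boolP (p %| m)%N) => //= /(mx p pp).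
have -> : \sum_(p <- primes_le x) (logn p m)%:R * ln (p%:R : R)
    = \sum_(p <- primes m) (logn p m)%:R * ln p%:R.
  rewrite (perm_big _ pm) /= big_filter [RHS]big_mkcond; apply: eq_bigr => p _.
  by case: ifPn => // npm; rewrite lognE (negbTE npm) !andbF mul0r.
have {1}-> : m = (\prod_(p <- primes m) p ^ logn p m)%N.
  by rewrite [LHS]prod_prime_decomp // prime_decompE big_map.
have : all prime (primes m) by apply/allP => p; rewrite mem_primes => /andP[].
elim: (primes m) => [_|p s IH /= /andP[pp ps]]; first by rewrite !big_nil ln1.
have s0 : (0 < \prod_(q <- s) q ^ logn q m)%N.
  rewrite big_seq; apply: prodn_cond_gt0 => q qs; rewrite expn_gt0.
  by rewrite prime_gt0 // (allP ps).
rewrite !big_cons natrM lnM ?posrE ?ltr0n ?expn_gt0 ?(prime_gt0 pp) //.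
by rewrite natrX lnXn ?ltr0n ?prime_gt0 // mulr_natl IH.
Qed.

(** Chebyshev's first function. *)
Definition theta (R : realType) (x : nat) : R := \sum_(p <- primes_le x) ln p%:R.

Lemma theta_le (R : realType) (x y : nat) : (x <= y)%N -> theta R x <= theta R y.
Proof.
move=> /subnK <-; elim: (y - x)%N => [//|d IH]; apply: le_trans IH _.
rewrite addSn /theta primes_leS big_cat /= lerDl.
by case: ifP => [/(ln_prime_gt0 R)/ltW|_]; rewrite ?big_nil // big_seq1.
Qed.

(** * Chebyshev's upper bound *)

(** The two central coefficients of the row [2m + 1] are equal and sum to at most
    [2 ^ (2m + 1)]. *)
Lemma bin_mid_le (m : nat) : ('C(m.*2.+1, m) <= 4 ^ m)%N.
Proof.
have e : 'C(m.*2.+1, m.+1) = 'C(m.*2.+1, m).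
  rewrite -[LHS]bin_sub; last by rewrite ltnS -addnn leq_addr.
  by congr 'C(_, _); rewrite -addnn; lia.
have := expnDn 1 1 m.*2.+1; rewrite addn1 => h.
have : ('C(m.*2.+1, m) + 'C(m.*2.+1, m.+1) <= 2 ^ m.*2.+1)%N.
  rewrite h (bigD1 (inord m)) //= (bigD1 (inord m.+1)) /=; last first.
    by rewrite -val_eqE /= !inordK //; lia.
  by rewrite !exp1n !inordK ?muln1; [rewrite addnA leq_addr|lia|lia].
rewrite e addnn expnS mul2n leq_double => /leq_trans; apply.
by rewrite -mul2n expnM.
Qed.

Lemma prime_dvd_fact (p n : nat) : prime p -> (p %| n`!)%N = (p <= n)%N.
Proof.
move=> pp; apply/idP/idP => [|h]; last by apply: dvdn_fact; rewrite prime_gt0.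
elim: n => [|n IH]; first by rewrite fact0 dvdn1 => /eqP p1; rewrite p1 in pp.
by rewrite factS Euclid_dvdM // => /orP[/dvdn_leq -> //|/IH]; exact: leqW.
Qed.

(** Each prime in [m + 1 < p <= 2m + 1] divides [(2m + 1)!] but neither [m!] nor
    [(m + 1)!], hence divides the binomial coefficient. *)
Lemma theta_bin_le (R : realType) (m : nat) :
  theta R m.*2.+1 <= theta R m.+1 + ln ('C(m.*2.+1, m))%:R.
Proof.
have mm : (m <= m.*2.+1)%N by lia.
have bf := bin_fact mm.
have f1 : (m.*2.+1 - m = m.+1)%N by lia.
rewrite f1 in bf.
rewrite (@ln_logn R m.*2.+1) ?bin_gt0 //; last first.
  move=> q pq qd; rewrite -(prime_dvd_fact _ _ pq) -bf; exact: dvdn_mulr.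
have -> : theta R m.+1 = \sum_(p <- primes_le m.*2.+1 | (p <= m.+1)%N) ln p%:R.
  rewrite /theta -[RHS]big_filter; apply: perm_big; apply: uniq_perm.
  - exact: primes_le_uniq.
  - by rewrite filter_uniq // primes_le_uniq.
  - by move=> p; rewrite [RHS]mem_filter !mem_primes_le; case: prime => //=; lia.
rewrite big_mkcond -big_split /= /theta; rewrite big_seq [leRHS]big_seq.
apply: ler_sum => p; rewrite mem_primes_le => /andP[pp px].
have l0 := ln_prime_gt0 R _ pp.
case: leqP => [_|mp]; first by rewrite lerDl mulr_ge0 // (ltW l0).
rewrite add0r -[leLHS]mul1r; apply: ler_wpM2r; first exact: ltW.
rewrite ler1n.
rewrite -pfactor_dvdn ?bin_gt0 // expn1.
have : (p %| (m.*2.+1)`!)%N by rewrite prime_dvd_fact.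
rewrite -bf Euclid_dvdM // Euclid_dvdM // !prime_dvd_fact //.
by rewrite (leqNgt p m.+1) mp (leqNgt p m) (ltnW mp) !orbF.
Qed.

(** Halving an odd [n] costs [ln 4 * (n - 1) / 2] by the two previous bounds; an even
    [n > 2] is not prime and reduces to [n - 1]. *)
Lemma theta_le_ln4 (R : realType) (n : nat) : theta R n <= n%:R * (2 * ln 2).
Proof.
have l2 := ln2_ge R.
elim/ltn_ind: n => n IH.
have [n2|n2] := leqP n 2.
  case: n n2 {IH} => [|[|[|n]]] //= _; rewrite /theta /primes_le /= ?big_nil ?big_seq1; lra.
have [no|ne] := boolP (odd n).
  have en : n = (n./2).*2.+1 by lia.
  set m := n./2 in en; rewrite en.
  have m1 : (m.+1 < n)%N by lia.
  apply: le_trans (theta_bin_le R m) _.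
  have h1 := IH _ m1.
  have h2 : ln (('C(m.*2.+1, m))%:R : R) <= m%:R * (2 * ln 2).
    have -> : m%:R * (2 * ln 2) = ln ((4 ^ m)%N%:R : R).
      by rewrite natrX lnXn // (_ : 4 = 2 * 2 :> R) ?lnM ?posrE //; [rewrite -mulr_natl; ring|ring].
    by rewrite ler_ln ?posrE ?ltr0n ?bin_gt0 ?expn_gt0 ?ler_nat ?bin_mid_le //; lia.
  apply: le_trans (lerD h1 h2) _; rewrite -mulrDl ler_wpM2r //; first by lra.
  by rewrite -natrD ler_nat; lia.
case: n n2 ne IH => // n n2 ne IH.
have -> : theta R n.+1 = theta R n.
  rewrite /theta primes_leS ifF ?cats0 //; apply/negP => /even_prime[e|o]; first lia.
  by rewrite o in ne.
apply: le_trans (IH n (ltnSn _)) _; rewrite ler_wpM2r ?ler_nat //; lra.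
Qed.

(** * Mertens' first theorem, upper half *)

Definition mertens_sum (R : realType) (x : nat) : R :=
  \sum_(p <- primes_le x) ln p%:R / p%:R.

(** Half of Stirling's formula. *)
Lemma ln_fact_le (R : realType) (n : nat) : (0 < n)%N ->
  ln ((n`!)%:R : R) <= (n%:R + 1) * ln n%:R - n%:R + 1.
Proof.
case: n => // n _; elim: n => [|n IH]; first by rewrite factS fact0 muln1 !ln1; lra.
rewrite factS natrM lnM ?posrE ?ltr0n ?fact_gt0 //.
have /andP[h _] := @ln_succ_sub_le R n.+1 isT.
have n0 : 0 < n.+2%:R :> R by rewrite ltr0n.
have e : n.+2%:R = n.+1%:R + 1 :> R by rewrite natr1.
have : 1 <= n.+2%:R * (ln n.+2%:R - ln (n.+1%:R : R)).
  by rewrite mulrC -ler_pdivrMr // mul1r.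
move: IH; rewrite e; move: (ln _) (ln n.+1%:R) (ln _) => a b c; lra.
Qed.

Lemma divn_le_logn_fact (p n : nat) : prime p -> (n %/ p <= logn p n`!)%N.
Proof.
move=> pp; rewrite logn_fact //; case: n => [|n]; first by rewrite div0n.
by rewrite big_ltn // expn1 leq_addr.
Qed.

(** The exponent of [p] in [n!] is at least [n %/ p], which exceeds [n / p - 1]. *)
Lemma sum_ln_le_ln_fact (R : realType) (n : nat) :
  n%:R * mertens_sum R n - theta R n <= ln (n`!)%:R.
Proof.
rewrite (@ln_logn R n) ?fact_gt0 //; last by move=> q pq; rewrite prime_dvd_fact.
rewrite /mertens_sum /theta mulr_sumr -sumrB big_seq [leRHS]big_seq.
apply: ler_sum => p /primes_le_prime pp.
have p0 : 0 < p%:R :> R by rewrite ltr0n prime_gt0.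
have -> : n%:R * (ln p%:R / p%:R) - ln p%:R = (n%:R / p%:R - 1) * ln (p%:R : R).
  by rewrite mulrBl mul1r; congr (_ - _); ring.
rewrite ler_wpM2r ?(ltW (ln_prime_gt0 _ _ pp)) // lerBlDr ler_pdivrMr //.
rewrite natr1 -natrM ler_nat; apply: ltnW.
apply: leq_trans (ltn_ceil n (prime_gt0 pp)) _.
by rewrite leq_mul2r ltnS divn_le_logn_fact ?orbT.
Qed.

(** Combining [sum_ln_le_ln_fact], Stirling and [theta n <= n ln 4], then dividing by
    [n]. *)
Lemma mertens_sum_le (R : realType) (n : nat) : (0 < n)%N ->
  mertens_sum R n <= ln n%:R + (2 * ln 2 - 1) + (1 + ln n%:R) / n%:R.
Proof.
move=> n0; have n0' : 0 < n%:R :> R by rewrite ltr0n.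
rewrite -(ler_pM2l n0').
have -> : n%:R * (ln n%:R + (2 * ln 2 - 1) + (1 + ln n%:R) / n%:R)
    = ((n%:R + 1) * ln n%:R - n%:R + 1) + n%:R * (2 * ln 2) :> R.
  by field; lra.
by rewrite -lerBlDr; apply: le_trans (ln_fact_le _ _ n0);
   apply: le_trans (sum_ln_le_ln_fact _ _); rewrite lerD2l lerN2 theta_le_ln4.
Qed.

(** * Chebyshev's lower bound *)

(** The ratio of consecutive central binomial coefficients is [2 (2n + 1) / (n + 1)], and
    [2 (n + 1) * 2 (2n + 1) / (n + 1) >= 4 * 2n]. *)
Lemma central_bin_ge (n : nat) : (0 < n)%N -> (4 ^ n <= n.*2 * 'C(n.*2, n))%N.
Proof.
case: n => // n _; elim: n => [|n IH]; first by [].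
have e1 : 'C(n.+2.*2, n.+2) = (2 * 'C(n.+1.*2.+1, n.+2))%N.
  rewrite doubleS binS -(@bin_sub n.+1.*2.+1 n.+1); last by lia.
  by rewrite (_ : n.+1.*2.+1 - n.+1 = n.+2)%N; lia.
have := mul_bin_diag n.+1.*2.+1 n.+1; rewrite /= => e2.
rewrite expnS e1 (_ : n.+2.*2 * _ = 4 * (n.+2 * 'C(n.+1.*2.+1, n.+2)))%N; last by rewrite -mul2n; ring.
rewrite leq_mul2l /= -e2; apply: leq_trans IH _.
by rewrite leq_mul2r leqnSn orbT.
Qed.

(** By Legendre's formula the exponent of [p] is the sum over [k] of
    [2n %/ p^k - 2 (n %/ p^k)]; each term is at most 1, and it is 0 once [p^k > 2n]. *)
Lemma logn_central_bin (p n : nat) : prime p -> (0 < n)%N ->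
  (p ^ logn p 'C(n.*2, n) <= n.*2)%N.
Proof.
move=> pp n0; have n20 : (0 < n.*2)%N by rewrite double_gt0.
have p1 := prime_gt1 pp.
suff h : (logn p 'C(n.*2, n) <= trunc_log p n.*2)%N.
  by apply: leq_trans (trunc_logP p1 n20); rewrite leq_exp2l.
have bf : ('C(n.*2, n) * (n`! * n`!) = n.*2`!)%N.
  by have := @bin_fact n.*2 n; rewrite -addnn addnK => -> //; rewrite leq_addr.
have := congr1 (logn p) bf.
rewrite lognM ?muln_gt0 ?fact_gt0 ?bin_gt0 // -?addnn ?leq_addr // addnn.
rewrite lognM ?fact_gt0 // !logn_fact //.
have -> : (\sum_(1 <= k < n.+1) n %/ p ^ k = \sum_(1 <= k < n.*2.+1) n %/ p ^ k)%N.
  rewrite [RHS](@big_cat_nat _ _ _ n.+1) //=; last by rewrite -addnn ltnS leq_addr.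
  rewrite [X in (_ + X)%N]big_nat [X in (_ + X)%N]big1 ?addn0 // => k /andP[nk _].
  by apply: divn_small; apply: leq_trans nk (ltnW (ltn_expl _ p1)).
have tl : (\sum_(1 <= k < n.*2.+1) (k <= trunc_log p n.*2)%N <= trunc_log p n.*2)%N.
  rewrite -big_mkcond /= sum1_count -size_filter.
  rewrite -[leqRHS](size_iota 1).
  apply: uniq_leq_size; first by rewrite filter_uniq // iota_uniq.
  by move=> k; rewrite mem_filter mem_index_iota => /andP[kt /andP[k1 _]];
   rewrite mem_iota k1 add1n ltnS.
have : (\sum_(1 <= k < n.*2.+1) n.*2 %/ p ^ k <=
    \sum_(1 <= k < n.*2.+1) (n %/ p ^ k + n %/ p ^ k + (k <= trunc_log p n.*2)))%N.
  apply: leq_sum => k _; have [kt|kt] := leqP k (trunc_log p n.*2).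
    have pk : (0 < p ^ k)%N by rewrite expn_gt0 prime_gt0.
    rewrite addn1 -ltnS -[X in (_ < X)%N]addn1 -addnS.
    by rewrite ltn_divLR // mulnDl -addnn; have := ltn_ceil n pk; nia.
  rewrite divn_small //; apply: leq_trans (trunc_log_ltn _ p1) _.
  by rewrite leq_exp2l.
rewrite !big_split /=; lia.
Qed.

(** A prime [p > s] has [p ^ 2 > 2n], so its exponent in the binomial coefficient is at most
    1 and it contributes at most [ln p]; each of the at most [s] smaller primes contributes
    at most [ln (2n)]. *)
Lemma ln_central_bin_le (R : realType) (n s : nat) : (0 < n)%N ->
  (n.*2 < s.+1 * s.+1)%N ->
  ln ('C(n.*2, n))%:R <= theta R n.*2 + s%:R * ln n.*2%:R.
Proof.
move=> n0 ns; set y := n.*2 in ns *.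
have y0 : (0 < y)%N by rewrite double_gt0.
have ny : (n <= y)%N by rewrite /y -addnn leq_addr.
have ly : 0 <= ln y%:R :> R by rewrite ln_ge0 // ler1n.
rewrite (@ln_logn R y) ?bin_gt0 //; last first.
  move=> q pq qd; rewrite -(prime_dvd_fact _ _ pq) -(bin_fact ny); exact: dvdn_mulr.
apply: le_trans (_ : _ <= theta R y + \sum_(p <- primes_le y | (p <= s)%N) ln y%:R) _; last first.
  rewrite lerD2l big_const_seq iter_addr_0 -[leLHS]mulr_natl ler_wpM2r // ler_nat -size_filter -[leqRHS](size_iota 1).
  apply: uniq_leq_size; first by rewrite filter_uniq // primes_le_uniq.
  move=> p; rewrite mem_filter mem_primes_le => /andP[ps /andP[/prime_gt0 p0 _]].
  by rewrite mem_iota p0 add1n ltnS.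
rewrite /theta [X in _ + X]big_mkcond -big_split /= big_seq [leRHS]big_seq.
apply: ler_sum => p /primes_le_prime pp.
have l0 := ln_prime_gt0 R _ pp.
have [ps|sp] := leqP p s.
  apply: le_trans (_ : _ <= ln y%:R) _; last by rewrite lerDr ltW.
  rewrite mulr_natl -lnXn ?ltr0n ?(prime_gt0 pp) // -natrX.
  rewrite ler_ln ?posrE ?ltr0n ?expn_gt0 ?(prime_gt0 pp) // ler_nat.
  exact: logn_central_bin.
rewrite addr0 -[leRHS]mul1r; apply: ler_wpM2r; first exact: ltW.
rewrite lern1 leqNgt; apply/negP => l2.
have := logn_central_bin _ _ pp n0; rewrite -/y leqNgt => /negP; apply.
apply: leq_trans ns _; apply: leq_trans (leq_mul sp sp) _.
by rewrite mulnn leq_exp2l // prime_gt1.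
Qed.

(** With [y] the even one of [x], [x - 1], and [s] the integer square root of [y], the
    bounds [4 ^ (y / 2) <= y * 'C(y, y / 2)] and [ln_central_bin_le] give
    [y ln 2 <= theta y + (s + 1) ln y]; the error term is of order [sqrt y * ln y], and is
    bounded through the tangent of [ln] at [32]. *)
Lemma theta_ge (R : realType) (x : nat) : (1024 <= x)%N ->
  46 / 100 * x%:R <= theta R x.
Proof.
move=> x1024; pose n := x./2; pose y := n.*2.
have yx : (y <= x <= y.+1)%N by rewrite /y /n; lia.
have y1024 : (1024 <= y)%N by rewrite /y /n; lia.
have n0 : (0 < n)%N by rewrite /n; lia.
have [s /andP[sy ys]] : exists s, (s * s <= y < s.+1 * s.+1)%N.
  have := PeanoNat.Nat.sqrt_spec y (PeanoNat.Nat.le_0_l y).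
  by move: (PeanoNat.Nat.sqrt y) => s h; exists s; lia.
have u33 : (33 <= s.+1)%N.
  by rewrite ltnNge; apply/negP => s32; have := leq_trans ys (leq_mul s32 s32); lia.
have hC := ln_central_bin_le R _ _ n0 ys.
have l2 := ln2_ge R.
have l2' := ln2_le R.
have y0 : (0 < y)%N by lia.
have h4 : n%:R * (2 * ln 2) <= ln y%:R + ln ('C(y, n))%:R :> R.
  have C0 : (0 < 'C(y, n))%N by rewrite bin_gt0 /y; lia.
  have -> : n%:R * (2 * ln 2) = ln ((4 ^ n)%N%:R : R).
    by rewrite natrX lnXn // (_ : 4 = 2 * 2 :> R) ?lnM ?posrE //; [rewrite -mulr_natl; ring|ring].
  rewrite -lnM ?posrE ?ltr0n // -natrM ler_ln ?posrE ?ltr0n ?expn_gt0 ?muln_gt0 ?y0 ?C0 // ler_nat.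
  exact: central_bin_ge.
have ln32 : ln 32 = 5 * ln 2 :> R.
  have -> : 32 = 2 ^+ 5 :> R by ring.
  by rewrite lnXn // -[LHS]mulr_natl.
have hu : ln s.+1%:R <= 5 * ln 2 + s.+1%:R / 32 - 1 :> R.
  by rewrite -ln32; apply: ln_le_tangent; rewrite ?ltr0n.
have hy : ln y%:R <= 2 * ln s.+1%:R :> R.
  rewrite mulr_natl -lnXn ?ltr0n // -natrX ler_ln ?posrE ?ltr0n ?expn_gt0 ?y0 // ler_nat.
  by rewrite -mulnn ltnW.
have tyx : theta R y <= theta R x by apply: theta_le; case/andP: yx.
have sy' : s%:R * s%:R <= y%:R :> R by rewrite -natrM ler_nat.
have xy' : x%:R <= y%:R + 1 :> R by rewrite natr1 ler_nat; case/andP: yx.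
have u33' : 33 <= s.+1%:R :> R by rewrite ler_nat.
have es : s.+1%:R = s%:R + 1 :> R by rewrite natr1.
have yn : y%:R = n%:R * 2 :> R by rewrite -natrM muln2.
move: hC h4 hu hy tyx sy' xy' u33' yn; rewrite -/y es.
move: (ln 'C(y, n)%:R) (ln y%:R) (theta R y) (theta R x) (ln (s%:R + 1)) => c ly ty tx lu.
move: (ln 2) l2 l2' (s%:R) (y%:R) (n%:R) (x%:R) => l l2 l2' s' y' n' x'.
move=> hC h4 hu hy tyx sy' xy' u33' yn.
have h1 : (s' + 1) * ly <= (s' + 1) * (2 * (5 * l + (s' + 1) / 32 - 1)).
  by rewrite ler_pM2l; lra.
have yl : y' * l = n' * (2 * l) by rewrite yn; ring.
have h2 : y' * l - (s' + 1) * (2 * (5 * l + (s' + 1) / 32 - 1)) <= tx by lra.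
have ss : 32 * s' <= s' * s' by rewrite ler_wpM2r; lra.
(* Since [y >= 10 (s + 1)], the coefficient of [ln 2] in [h2] is nonnegative, and [ln 2] can
   be replaced by 0.69. *)
have h3 : 0 <= (y' - 10 * (s' + 1)) * (l - 69 / 100) by apply: mulr_ge0; lra.
lra.
Qed.

(** * The growth of the product over primes *)

(** The value of [dedekind_psi n / n] when the prime divisors of [n] are exactly the primes
    up to [x]. *)
Definition psi_prod (R : realType) (x : nat) : R := \prod_(p <- primes_le x) (1 + p%:R^-1).

Lemma psi_prod_gt0 (R : realType) (x : nat) : 0 < psi_prod R x.
Proof. by apply: prodr_gt0 => p _; rewrite ltr_pwDl // invr_ge0. Qed.

Lemma psi_prodS (R : realType) (x : nat) :
  psi_prod R x.+1 = psi_prod R x * (if prime x.+1 then 1 + x.+1%:R^-1 else 1).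
Proof.
rewrite /psi_prod primes_leS big_cat /=; congr (_ * _).
by case: ifP; rewrite ?big_seq1 ?big_nil.
Qed.

Lemma mertens_sumS (R : realType) (x : nat) : mertens_sum R x.+1 =
  mertens_sum R x + (if prime x.+1 then ln x.+1%:R / x.+1%:R else 0).
Proof.
rewrite /mertens_sum primes_leS big_cat /=; congr (_ + _).
by case: ifP; rewrite ?big_seq1 ?big_nil.
Qed.

(** Partial summation in the form of a potential.  Write [P] for the product, [A] for the
    sum of [ln p / p], and suppose [A n <= ln n + E] for [n >= m].  Then
    [phi n = ln (P n) - ln (ln n) + (ln n + E - A n) / ln n] is nonincreasing on [n >= m]:
    a prime [n + 1 = p] adds at most [1 / p] to [ln P] and takes exactly [1 / p] from the
    last term, while, with [L = ln n] and [L' = ln (n + 1)], the remaining change is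
    [(1 - L / L') - ln (L' / L) + (L + E - A n) (1 / L' - 1 / L)], a sum of two nonpositive
    quantities.  The last term of [phi x] is nonnegative and is dropped. *)
Lemma ln_psi_prod_le (R : realType) (m : nat) (E : R) : (2 <= m)%N ->
  (forall n, (m <= n)%N -> mertens_sum R n <= ln n%:R + E) ->
  forall x, (m <= x)%N ->
  ln (psi_prod R x) <= ln (ln x%:R) + (ln (psi_prod R m) - ln (ln m%:R)
                        + (ln m%:R + E - mertens_sum R m) / ln m%:R).
Proof.
move=> m2 hA; pose phi n : R := ln (psi_prod R n) - ln (ln n%:R)
   + (ln n%:R + E - mertens_sum R n) / ln n%:R.
have phiS n : (m <= n)%N -> phi n.+1 <= phi n.
  move=> mn; have n2 : (1 < n)%N := leq_trans m2 mn.
  have B0 := hA n mn.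
  have L0 : 0 < ln n%:R :> R by rewrite ln_gt0 // ltr1n.
  have LL : ln n%:R < ln n.+1%:R :> R.
    by rewrite ltr_ln ?posrE ?ltr0n ?ltr_nat // ltnW.
  have L0' : 0 < ln n.+1%:R :> R := lt_trans L0 LL.
  have h : ln (psi_prod R n.+1) - mertens_sum R n.+1 / ln n.+1%:R <=
           ln (psi_prod R n) - mertens_sum R n / ln n.+1%:R.
    rewrite psi_prodS mertens_sumS; case: ifP => _; last by rewrite mulr1 addr0.
    have i0 : 0 < n.+1%:R^-1 :> R by rewrite invr_gt0 ltr0n.
    have i1 : 0 < 1 + n.+1%:R^-1 :> R by rewrite addr_gt0.
    rewrite lnM ?posrE ?psi_prod_gt0 //.
    have -> : (mertens_sum R n + ln n.+1%:R / n.+1%:R) / ln n.+1%:R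
       = mertens_sum R n / ln n.+1%:R + n.+1%:R^-1 :> R.
      by rewrite mulrDl mulrAC divff ?mul1r // gt_eqF.
    have h1 : ln (1 + n.+1%:R^-1) <= n.+1%:R^-1 :> R.
      by apply: le_ln1Dx; apply: lt_trans i0; rewrite ltrN10.
    by rewrite opprD addrACA -[leRHS]addr0 lerD2l subr_le0.
  have h2 := ln_ge_1sub_inv _ _ (divr_gt0 L0' L0).
  rewrite ln_div ?posrE // invf_div in h2.
  have h3 : (ln n%:R + E - mertens_sum R n) / ln n.+1%:R <=
            (ln n%:R + E - mertens_sum R n) / ln n%:R.
    by rewrite ler_wpM2l ?subr_ge0 // lef_pV2 ?posrE // ltW.
  move: h h2 h3; rewrite /phi.
  have -> : (ln n.+1%:R + E - mertens_sum R n.+1) / ln n.+1%:R =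
     1 + E / ln n.+1%:R - mertens_sum R n.+1 / ln n.+1%:R :> R by field; lra.
  have -> : (ln n%:R + E - mertens_sum R n) / ln n.+1%:R = ln n%:R / ln n.+1%:R
     + E / ln n.+1%:R - mertens_sum R n / ln n.+1%:R :> R by field; lra.
  move: (_ / _) (_ / _) (_ / _) (_ / _) (_ / _) => a b c d e; lra.
move=> x mx; have phi_le : phi x <= phi m.
  move: mx => /subnK <-; elim: (x - m)%N => [//|d IH].
  by apply: le_trans IH; apply: phiS; rewrite leq_addl.
have : 0 <= (ln x%:R + E - mertens_sum R x) / ln x%:R.
  apply: divr_ge0; first by have := hA x mx; lra.
  by apply: ln_ge0; rewrite ler1n; lia.
by move: phi_le; rewrite /phi; move: (_ / _) (_ / _) => a b; lra.
Qed.

(** * Fixed-point evaluation over lists of primes *)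

(** An upper bound, rounded up at each factor, of [c] times the product of the
    [1 + 1 / p]. *)
Definition prod_up (c : N) (s : seq nat) : N :=
  foldr (fun p x => N.succ (x + x / N.of_nat p)) c s.

Lemma N_to_natR_le (R : realType) (a b : N) :
  N.leb a b -> (N.to_nat a)%:R <= (N.to_nat b)%:R :> R.
Proof. by move=> /N.leb_le h; rewrite ler_nat; lia. Qed.

Lemma prod_up_ge (R : realType) (c : N) (s : seq nat) : all prime s ->
  (N.to_nat c)%:R * \prod_(p <- s) (1 + p%:R^-1) <= (N.to_nat (prod_up c s))%:R :> R.
Proof.
elim: s => [|p s IH /= /andP[pp ps]]; first by rewrite big_nil mulr1.
have p0 : (0 < p)%N := prime_gt0 pp.
have p0' : 0 < p%:R :> R by rewrite ltr0n.
rewrite big_cons mulrCA; move: (prod_up c s) (IH ps) => x {}IH.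
apply: le_trans (_ : (1 + p%:R^-1) * (N.to_nat x)%:R <= _).
  by rewrite ler_wpM2l // addr_ge0 // invr_ge0 ltW.
have hd : (N.to_nat x <= p * (N.to_nat (x / N.of_nat p)%num).+1)%N.
  have := N.mul_succ_div_gt x (N.of_nat p) ltac:(lia).
  move: (x / _)%num => q h.
  have : (N.to_nat x < N.to_nat (N.of_nat p * N.succ q))%N by lia.
  by rewrite N2Nat.inj_mul Nnat.Nat2N.id N2Nat.inj_succ => /ltnW.
move: hd; move: (x / _)%num => q hd.
rewrite mulrDl mul1r N2Nat.inj_succ N2Nat.inj_add -addnS natrD lerD2l.
by rewrite mulrC ler_pdivrMr // -natrM ler_nat mulnC.
Qed.

(** The free factor [M] sets the number of digits carried by the computation. *)
Lemma psi_prod_le_check (R : realType) (M : N) (u d x : nat) : (0 < d)%N ->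
  N.ltb 0 M -> N.leb (prod_up (M * N.of_nat d) (primes_le x)) (M * N.of_nat u) ->
  psi_prod R x <= u%:R / d%:R.
Proof.
move=> d0 /N.ltb_lt M0 /(N_to_natR_le R).
have M0' : 0 < (N.to_nat M)%:R :> R by rewrite ltr0n; lia.
have d0' : 0 < d%:R :> R by rewrite ltr0n.
have pr : all prime (primes_le x) by apply/allP => p /primes_le_prime.
move=> /(le_trans (prod_up_ge R _ _ pr)).
rewrite !N2Nat.inj_mul !Nnat.Nat2N.id !natrM -mulrA ler_pM2l //.
by rewrite ler_pdivlMr // mulrC.
Qed.

(** A lower bound, rounded down at each term, of [16 * c] times the sum of
    [log2 p / f p]; taking the integer part of [log2] only after raising [p] to the power
    16 keeps four more binary digits. *)
Definition log_low (c : N) (f : nat -> nat) (s : seq nat) : N :=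
  foldr (fun p x => c * N.log2 (N.of_nat p ^ 16) / N.of_nat (f p) + x)%num 0%num s.

Lemma N_to_nat_pow (a b : N) : N.to_nat (a ^ b)%num = (N.to_nat a ^ N.to_nat b)%N.
Proof.
rewrite N2Nat.inj_pow; elim: (N.to_nat b) => //= n ->; by rewrite expnS.
Qed.

Lemma log2_le (R : realType) (p : nat) : (0 < p)%N ->
  (N.to_nat (N.log2 (N.of_nat p ^ 16)))%:R * ln 2 <= 16 * ln p%:R :> R.
Proof.
move=> p0; have := N.log2_spec (N.of_nat p ^ 16) ltac:(lia).
move: (N.log2 _) => l [h _].
have : (2 ^ N.to_nat l <= p ^ 16)%N.
  have : (N.to_nat (2 ^ l) <= N.to_nat (N.of_nat p ^ 16))%N by lia.
  by rewrite !N_to_nat_pow Nnat.Nat2N.id.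
rewrite -(@ler_nat R) !natrX => h2.
rewrite mulr_natl -lnXn // mulr_natl -lnXn ?ltr0n //.
by rewrite ler_ln ?posrE ?exprn_gt0 ?ltr0n.
Qed.

Lemma log_low_le (R : realType) (c : N) (f : nat -> nat) (s : seq nat) : all prime s ->
  (forall p, prime p -> (0 < f p)%N) ->
  (N.to_nat (log_low c f s))%:R * ln 2 <=
     (N.to_nat c)%:R * (16 * \sum_(p <- s) ln p%:R / (f p)%:R) :> R.
Proof.
move=> + f0; elim: s => [|p s IH /= /andP[pp ps]]; first by rewrite big_nil mul0r !mulr0.
rewrite N2Nat.inj_add natrD mulrDl big_cons !mulrDr lerD ?IH //.
have fp : 0 < (f p)%:R :> R by rewrite ltr0n f0.
have l2 : 0 < ln 2 :> R by have := ln2_ge R; lra.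
have h := log2_le R p (prime_gt0 pp).
move: (N.log2 _) h => l h.
have hd : ((N.to_nat (c * l / N.of_nat (f p))) * f p <= N.to_nat c * N.to_nat l)%N.
  have := N.mul_div_le (c * l) (N.of_nat (f p)) ltac:(have := f0 _ pp; lia).
  move: (_ / _)%num => q h'.
  have : (N.to_nat (N.of_nat (f p) * q) <= N.to_nat (c * l))%N by lia.
  by rewrite !N2Nat.inj_mul Nnat.Nat2N.id mulnC.
move: hd; move: (_ / _)%num => q; rewrite -(@ler_nat R) !natrM => hd.
rewrite !mulrA ler_pdivlMr // mulrAC.
apply: le_trans (_ : _ <= (N.to_nat c)%:R * (N.to_nat l)%:R * ln 2) _.
  by rewrite ler_wpM2r // ltW.
by rewrite -!mulrA ler_wpM2l.
Qed.

Lemma log_low_check (R : realType) (M : N) (f : nat -> nat) (u x : nat) :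
  (forall p, prime p -> (0 < f p)%N) ->
  N.ltb 0 M -> N.leb (M * N.of_nat u) (log_low M f (primes_le x)) ->
  u%:R * ln 2 <= 16 * \sum_(p <- primes_le x) ln p%:R / (f p)%:R :> R.
Proof.
move=> f0 /N.ltb_lt M0 /(N_to_natR_le R).
have M0' : 0 < (N.to_nat M)%:R :> R by rewrite ltr0n; lia.
have l2 : 0 < ln 2 :> R by have := ln2_ge R; lra.
have pr : all prime (primes_le x) by apply/allP => p /primes_le_prime.
rewrite N2Nat.inj_mul Nnat.Nat2N.id natrM -(ler_pM2r l2) => /le_trans/(_ (log_low_le R M f _ pr f0)).
by rewrite -mulrA ler_pM2l.
Qed.

Lemma psi_prod_1024 (R : realType) : psi_prod R 1024 <= 755 / 100.
Proof. by apply: (psi_prod_le_check _ (10 ^ 6)%num) => //; vm_compute. Qed.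

Lemma mertens_sum_check (R : realType) (M : N) (u x : nat) : N.ltb 0 M ->
  N.leb (M * N.of_nat u) (log_low M id (primes_le x)) ->
  u%:R / 16 * ln 2 <= mertens_sum R x.
Proof.
move=> M0 /(log_low_check R M id u x (fun p => @prime_gt0 p) M0).
rewrite -/(mertens_sum R x); lra.
Qed.

Lemma theta_check (R : realType) (u x : nat) :
  N.leb (N.of_nat u) (log_low 1 (fun=> 1%N) (primes_le x)) ->
  u%:R / 16 * ln 2 <= theta R x.
Proof.
move=> h; have := log_low_check R 1%num (fun=> 1%N) u x (fun _ _ => isT) isT.
rewrite N.mul_1_l => /(_ h); under eq_bigr do rewrite divr1.
rewrite -/(theta R x); lra.
Qed.

Lemma mertens_sum_1024 (R : realType) : 129 / 16 * ln 2 <= mertens_sum R 1024.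
Proof. by apply: (mertens_sum_check _ (10 ^ 6)%num 129); [|vm_compute]. Qed.

(** * The product over primes against Chebyshev's function *)

(** The numerical content of the estimate for [x >= 1024], with [l = ln 2],
    [ln 1024 = 10 l], [Pm] and [A] the product and the sum at 1024, [P] the product at [x],
    [y = x] and [th = theta x].  The last quotient is at most 0.26, and [Pm / (10 l)] at
    most 1.095.  Hence [P <= 1.422 ln y], while
    [ln th >= ln y - 0.8], and [1.422 ln y < 1.72 (ln y - 0.8)] as soon as [ln y >= 6.9]. *)
Lemma tail_numerics (R : realType) (l E Pm A P y th : R) :
  69 / 100 <= l -> l <= 7 / 10 -> E <= 2 * l - 1 + 8 / 1000 ->
  0 < Pm -> Pm <= 755 / 100 -> 129 / 16 * l <= A -> 0 < P -> 0 < y ->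
  69 / 10 <= ln y -> 46 / 100 * y <= th ->
  ln P <= ln (ln y) + (ln Pm - ln (10 * l) + (10 * l + E - A) / (10 * l)) ->
  P < 172 / 100 * ln th.
Proof.
have e26 : expR (26 / 100) <= 1298 / 1000 :> R.
  by apply: (expR_le_taylor3 _ _ _ 1); first by []; rewrite /exp_taylor3; lra.
have hc : - (8 / 10) <= ln (46 / 100) :> R.
  by apply: (ge_ln_taylor3 _ _ _ 4); first by []; rewrite /exp_taylor3; lra.
have e0 := expR_gt0 (26 / 100 : R).
move=> l2 l2' EB Pm0 hPm hA P0 y0 ly hth hP.
have l0 : 0 < 10 * l by clear - l2; lra.
have ly0 : 0 < ln y by apply: lt_le_trans ly; rewrite divr_gt0.
have q : (10 * l + E - A) / (10 * l) <= 26 / 100.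
  by rewrite ler_pdivrMr //; clear - l2 l2' EB hA; lra.
have r0 : 0 < Pm / (10 * l) by exact: divr_gt0.
have r1 : Pm / (10 * l) <= 1095 / 1000.
  by rewrite ler_pdivrMr //; clear - hPm l2; lra.
have m0 : 0 < ln y * (Pm / (10 * l)) by exact: mulr_gt0.
have hln : ln P <= ln (ln y * (Pm / (10 * l)) * expR (26 / 100)).
  rewrite lnM ?posrE // expRK lnM ?posrE // ln_div ?posrE //.
  by apply: le_trans hP _; rewrite -[leRHS]addrA !lerD2l.
have hPy : P <= ln y * (1422 / 1000).
  move: hln; rewrite ler_ln ?posrE //; last by exact: mulr_gt0.
  move=> hln; apply: le_trans hln _; rewrite -mulrA ler_wpM2l ?(ltW ly0) //.
  move: (Pm / _) (expR _) r0 r1 e26 e0 => a b r0 r1 e26 e0.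
  by clear - r0 r1 e26 e0; nra.
have c0 : 0 < 46 / 100 :> R by rewrite divr_gt0.
have cy0 : 0 < 46 / 100 * y by exact: mulr_gt0.
have hlth : ln (46 / 100) + ln y <= ln th.
  by rewrite -lnM ?posrE // ler_ln ?posrE // (lt_le_trans cy0).
apply: le_lt_trans hPy _; clear - hc hlth ly.
by move: (ln (_ / _)) (ln th) (ln y) hc hlth ly => c d e hc hlth ly; lra.
Qed.

Lemma psi_prod_lt_tail (R : realType) (x : nat) : (1024 <= x)%N ->
  psi_prod R x < 172 / 100 * ln (theta R x).
Proof.
move=> x1024; have hP := psi_prod_1024 R; have hA := mertens_sum_1024 R.
have l2 := ln2_ge R; have l2' := ln2_le R.
have lm : ln 1024%:R = 10 * ln 2 :> R.
  rewrite (_ : 1024%:R = 2 ^+ 10 :> R); last by rewrite -natrX.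
  by rewrite lnXn // -[LHS]mulr_natl.
have lx : 69 / 10 <= ln x%:R :> R.
  apply: le_trans (_ : ln 1024%:R <= _); first by rewrite lm; clear - l2; lra.
  rewrite ler_ln ?posrE ?ltr0n ?ler_nat //; exact: leq_trans x1024.
have x0 : 0 < x%:R :> R by rewrite ltr0n; exact: leq_trans x1024.
have c1000 : 1000 <= 1024%:R :> R by rewrite ler_nat.
pose E : R := (2 * ln 2 - 1) + (1 + 10 * ln 2) / 1024%:R.
have hE n : (1024 <= n)%N -> mertens_sum R n <= ln n%:R + E.
  move=> hn; have n0 : (0 < n)%N by exact: leq_trans hn.
  apply: le_trans (mertens_sum_le _ _ n0) _.
  by rewrite /E -lm -addrA lerD2l lerD2l; exact: ln_div_le.
have EB : E <= 2 * ln 2 - 1 + 8 / 1000.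
  rewrite lerD2l ler_pdivrMr; last by apply: lt_le_trans c1000; rewrite ltr0n.
  by move: (1024%:R) c1000 => c c1000; clear - c1000 l2 l2'; nra.
have := ln_psi_prod_le R 1024 E isT hE x x1024; rewrite lm.
have P0 := psi_prod_gt0 R x; have Pm0 := psi_prod_gt0 R 1024.
have ht := theta_ge R _ x1024.
exact: (tail_numerics _ (ln 2) E (psi_prod R 1024) (mertens_sum R 1024) _ x%:R).
Qed.

Lemma psi_prod_le (R : realType) (x y : nat) : (x <= y)%N -> psi_prod R x <= psi_prod R y.
Proof.
move=> /subnK <-; elim: (y - x)%N => [//|d IH]; apply: le_trans IH _.
rewrite addSn psi_prodS; case: ifP => _; last by rewrite mulr1.
by rewrite ler_pMr ?psi_prod_gt0 // lerDl invr_ge0.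
Qed.

(** Both sides are monotone in [x], so an interval [a <= x <= b] needs only the product at
    [b] and the sum at [a]. *)
Lemma psi_prod_lt_block (R : realType) (a b x : nat) (U q y : R) :
  psi_prod R b <= U -> y <= theta R a -> q <= ln y -> 0 < y ->
  U < 172 / 100 * q -> (a <= x <= b)%N -> psi_prod R x < 172 / 100 * ln (theta R x).
Proof.
move=> hU hy hq y0 Uq /andP[ax xb].
apply: le_lt_trans (psi_prod_le _ _ _ xb) _; apply: le_lt_trans hU _.
apply: lt_le_trans Uq _; rewrite ler_pM2l ?divr_gt0 //; apply: le_trans hq _.
have tx := le_trans hy (theta_le R _ _ ax).
by rewrite ler_ln ?posrE // (lt_le_trans y0).
Qed.

(** The left side is well below the right one except for the smallest [x], so five
    intervals of rapidly growing length cover [7 <= x < 1024]. *)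
Lemma psi_prod_lt (R : realType) (x : nat) : (7 <= x)%N ->
  psi_prod R x < 172 / 100 * ln (theta R x).
Proof.
move=> x7; have l2 := ln2_ge R.
have [x1024|x1024] := leqP 1024 x.
  exact: psi_prod_lt_tail.
(* In each case the three constants are a bound U of the product at the right end, a number
   q with U < 1.72 q, and a lower bound y >= exp q of theta at the left end. *)
have [x503|x503] := leqP 503 x.
  apply: (@psi_prod_lt_block R 503 1023 x (755 / 100) (45 / 10) 100).
  - by apply: le_trans (psi_prod_1024 R); exact: psi_prod_le.
  - apply: le_trans (theta_check R 2400 503 _); [lra|by vm_compute].
  - by apply: (@ge_ln_taylor3 _ _ _ 8); first by []; rewrite /exp_taylor3; lra.
  - by lra.
  - lra.
  - by rewrite x503.
have [x67|x67] := leqP 67 x.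
  apply: (@psi_prod_lt_block R 67 502 x (680 / 100) 4 55).
  - by apply: (psi_prod_le_check _ (10 ^ 6)%num) => //; vm_compute.
  - apply: le_trans (theta_check R 1280 67 _); [lra|by vm_compute].
  - by apply: (@ge_ln_taylor3 _ _ _ 16); first by []; rewrite /exp_taylor3; lra.
  - by lra.
  - lra.
  - by rewrite x67.
have [x19|x19] := leqP 19 x.
  apply: (@psi_prod_lt_block R 19 66 x (465 / 100) (272 / 100) (158 / 10)).
  - by apply: (psi_prod_le_check _ (10 ^ 6)%num) => //; vm_compute.
  - apply: le_trans (theta_check R 368 19 _); [lra|by vm_compute].
  - by apply: (@ge_ln_taylor3 _ _ _ 8); first by []; rewrite /exp_taylor3; lra.
  - by lra.
  - lra.
  - by rewrite x19.
have [x11|x11] := leqP 11 x.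
  apply: (@psi_prod_lt_block R 11 18 x (342 / 100) 2 (76 / 10)).
  - by apply: (psi_prod_le_check _ (10 ^ 6)%num) => //; vm_compute.
  - apply: le_trans (theta_check R 177 11 _); [lra|by vm_compute].
  - by apply: (@ge_ln_taylor3 _ _ _ 8); first by []; rewrite /exp_taylor3; lra.
  - by lra.
  - lra.
  - by rewrite x11.
apply: (@psi_prod_lt_block R 7 10 x (275 / 100) (16 / 10) (52 / 10)).
- by apply: (psi_prod_le_check _ (10 ^ 6)%num) => //; vm_compute.
- apply: le_trans (theta_check R 122 7 _); [lra|by vm_compute].
- by apply: (@ge_ln_taylor3 _ _ _ 8); first by []; rewrite /exp_taylor3; lra.
- by lra.
- lra.
- by rewrite x7.
Qed.

(** * Primorials *)

Lemma next_primeP (x : nat) : [/\ (x < next_prime x)%N, prime (next_prime x) &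
  forall q, prime q -> (x < q)%N -> (next_prime x <= q)%N].
Proof.
rewrite /next_prime; case: ex_minnP => p /andP[xp pp] pmin; split=> // q pq xq.
by apply: pmin; rewrite xq.
Qed.

Lemma next_prime_eq (x q : nat) : (x < q)%N -> prime q ->
  (forall r, prime r -> (x < r)%N -> (q <= r)%N) -> next_prime x = q.
Proof.
move=> xq pq qmin; have [xn pn nmin] := next_primeP x.
by apply/eqP; rewrite eqn_leq nmin // qmin.
Qed.

Lemma prime_le_next_prime (x q : nat) : prime q ->
  (q <= next_prime x)%N = (q <= x)%N || (q == next_prime x).
Proof.
move=> pq; have [xn pn nmin] := next_primeP x.
apply/idP/orP => [qn|[qx|/eqP -> //]]; last by apply: ltnW; apply: leq_ltn_trans qx xn.
by have [qx|xq] := leqP q x; [left|right; rewrite eqn_leq qn nmin].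
Qed.

Lemma primorialS (k : nat) : primorial k.+1 = (primorial k * nth_prime k.+1)%N.
Proof. by rewrite /primorial big_nat_recr. Qed.

Lemma primorial_gt0 (k : nat) : (0 < primorial k)%N.
Proof.
elim: k => [|k IH]; first by rewrite /primorial big_geq.
by rewrite primorialS muln_gt0 IH; have [_ /prime_gt0] := next_primeP (nth_prime k).
Qed.

Lemma prime_dvd_primorial (q k : nat) : prime q ->
  (q %| primorial k)%N = (q <= nth_prime k)%N.
Proof.
move=> pq; elim: k => [|k IH].
  by rewrite /primorial big_geq //= dvdn1 leqNgt prime_gt1 //; case: q pq => [|[]].
have [_ pn _] := next_primeP (nth_prime k).
by rewrite primorialS Euclid_dvdM // IH /= prime_le_next_prime // dvdn_prime2.
Qed.

Lemma theta_nth_prime (R : realType) (k : nat) :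
  theta R (nth_prime k) = ln (primorial k)%:R.
Proof.
elim: k => [|k IH]; first by rewrite /theta /primes_le /= big_nil /primorial big_geq // ln1.
have [xn pn nmin] := next_primeP (nth_prime k).
rewrite primorialS natrM lnM ?posrE ?ltr0n ?primorial_gt0 ?(prime_gt0 pn) // -IH.
suff pe : perm_eq (primes_le (nth_prime k.+1)) (nth_prime k.+1 :: primes_le (nth_prime k)).
  by rewrite /theta (perm_big _ pe) big_cons addrC.
apply: uniq_perm.
- exact: primes_le_uniq.
- by rewrite /= primes_le_uniq mem_primes_le pn /= -ltnNge xn.
move=> q; rewrite inE !mem_primes_le.
case: (boolP (prime q)) => [pq|/negP pq] /=; first by rewrite prime_le_next_prime // orbC.
by apply/esym/negbTE/negP; rewrite orbF => /eqP e; rewrite e in pq.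
Qed.

(** The hypothesis forces [l] to be smaller than the next prime, so [l] brings no new prime
    divisor. *)
Lemma dedekind_psi_primorial (R : realType) (k l : nat) : (1 <= l)%N ->
  (l * primorial k < primorial k.+1)%N ->
  dedekind_psi R (l * primorial k) / (l * primorial k)%:R = psi_prod R (nth_prime k).
Proof.
move=> l1 hlt; have N0 := primorial_gt0 k.
have n0 : (0 < l * primorial k)%N by rewrite muln_gt0 l1.
rewrite /dedekind_psi mulrAC divff ?mul1r ?pnatr_eq0 -?lt0n //.
rewrite /psi_prod; apply: perm_big; apply: uniq_perm.
- exact: primes_uniq.
- exact: primes_le_uniq.
move=> q; rewrite mem_primes mem_primes_le n0 /=; case: (boolP (prime q)) => //= pq.
rewrite Euclid_dvdM // prime_dvd_primorial //; apply/orP/idP => [[ql|//]|]; last by right.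
move: hlt; rewrite primorialS mulnC ltn_pmul2l // => lp.
have [_ _ nmin] := next_primeP (nth_prime k).
rewrite leqNgt; apply/negP => /(nmin q pq); apply/negP; rewrite -ltnNge.
exact: leq_ltn_trans (dvdn_leq l1 ql) lp.
Qed.

Lemma nth_prime_small : [/\ nth_prime 1 = 2, nth_prime 2 = 3, nth_prime 3 = 5 & nth_prime 4 = 7]%N.
Proof.
have h1 : nth_prime 1 = 2%N by apply: next_prime_eq => // r /prime_gt1.
have h2 : nth_prime 2 = 3%N by rewrite -[LHS]/(next_prime (nth_prime 1)) h1; apply: next_prime_eq.
have h3 : nth_prime 3 = 5%N.
  by rewrite -[LHS]/(next_prime (nth_prime 2)) h2; apply: next_prime_eq => // -[|[|[|[|[]]]]].
have h4 : nth_prime 4 = 7%N.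
  by rewrite -[LHS]/(next_prime (nth_prime 3)) h3; apply: next_prime_eq => // -[|[|[|[|[|[|[]]]]]]].
by [].
Qed.

Lemma psi_prod_5 (R : realType) : psi_prod R 5 = 12 / 5.
Proof.
by rewrite /psi_prod (_ : primes_le 5 = [:: 2; 3; 5]%N) // !big_cons big_nil; field.
Qed.

(** * The inequality *)

Theorem mainTheorem3 (R : realType) (n k l : nat) (hn : (30 < n)%N)
    (hk : (1 <= k)%N) (hl : (1 <= l)%N) (hnkl : n = (l * primorial k)%N)
    (hlt : (l * primorial k < primorial k.+1)%N) :
  dedekind_psi R n / n%:R - expR (euler_gamma R) * ln (ln n%:R) < 0.
Proof.
subst n; rewrite dedekind_psi_primorial // subr_lt0.
have [p1 p2 p3 p4] := nth_prime_small.
have P1 : primorial 1 = 2%N by rewrite /primorial big_nat1.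
have P2 : primorial 2 = 6%N by rewrite primorialS P1 p2.
have P3 : primorial 3 = 30%N by rewrite primorialS P2 p3.
have g := expR_euler_gamma_ge R.
(* The second conjunct makes [ln (ln n)] nonnegative, which allows [exp gamma] to be
   replaced by its lower bound. *)
suff : psi_prod R (nth_prime k) < 172 / 100 * ln (ln (l * primorial k)%:R) /\
       1 <= ln ((l * primorial k)%:R : R).
  move=> [h /ln_ge0 h1]; apply: lt_le_trans h _; exact: ler_wpM2r.
have l60 := ln60_ge R.
have n60 : (60 <= l * primorial k)%N.
  case: k hk hn hlt => [|[|[|[|k]]]] // _; rewrite ?P1 ?P2 ?P3; try lia.
  move=> hn _; have : (primorial 4 <= l * primorial k.+4)%N.
    apply: leq_trans (_ : primorial k.+4 <= _)%N; last by rewrite leq_pmull.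
    elim: k {hn} => // k IH; apply: leq_trans IH _; rewrite [leqRHS]primorialS.
    by rewrite leq_pmulr //; have [_ /prime_gt0] := next_primeP (nth_prime k.+4).
  by rewrite primorialS P3 p4; apply: leq_trans.
have lnn : 408 / 100 <= ln ((l * primorial k)%:R : R).
  apply: le_trans l60 _; rewrite ler_ln ?posrE ?ltr0n ?ler_nat //; exact: leq_trans n60.
split; last by lra.
case: k hk hn hlt n60 lnn => [|[|[|[|k]]]] // _; rewrite ?P1 ?P2; try lia.
(* Here n >= 60, where both sides are close: 12 / 5 against 1.72 * 1.4. *)
- move=> _ _ _ lnn; rewrite p3 psi_prod_5.
  have : 14 / 10 <= ln (408 / 100 : R).
    by apply: (@ge_ln_taylor3 _ _ _ 8); first by []; rewrite /exp_taylor3; lra.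
  have : ln (408 / 100 : R) <= ln (ln (l * primorial 3)%:R).
    have c0 : 0 < 408 / 100 :> R by apply: divr_gt0; rewrite ltr0n.
    by rewrite ler_ln ?posrE // (lt_le_trans c0).
  move: (ln (_ / _)) (ln (ln _)) => a b; lra.
move=> _ _ _ lnn; apply: lt_le_trans (psi_prod_lt R (nth_prime k.+4) _) _.
  elim: k {lnn} => [|k IH]; first by rewrite p4.
  by apply: leq_trans IH (ltnW _); have [] := next_primeP (nth_prime k.+4).
rewrite theta_nth_prime ler_pM2l ?divr_gt0 // ler_ln ?posrE.
- by rewrite ler_ln ?posrE ?ltr0n ?muln_gt0 ?hl ?primorial_gt0 // ler_nat leq_pmull.
- apply: lt_le_trans (_ : ln (2 : R) <= _); first by have := ln2_ge R; lra.
  rewrite ler_ln ?posrE ?ltr0n ?primorial_gt0 // ler_nat dvdn_leq ?primorial_gt0 //.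
  rewrite prime_dvd_primorial // -p1; elim: (k.+3) => // j IH.
  by apply: leq_trans IH (ltnW _); have [] := next_primeP (nth_prime j.+1).
- lra.
Qed.
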